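(* For all integers $k,m,n\ge 0$, the number of partitions $\lambda$ of $n$ with alternating sum $l_a(\lambda)=k$ such that each even part appears at most $2m+1$ times equals the number of partitions $\mu$ of $n$ with exactly $k$ odd parts (counted with multiplicity) such that each even part appears at most $2m+1$ times.
   Context: For a partition $\lambda=(\lambda_1\ge\lambda_2\ge\cdots\ge\lambda_r>0)$, the alternating sum is $l_a(\lambda)=\lambda_1-\lambda_2+\lambda_3-\lambda_4+\cdots$. *)

(* Defs.v *)
From HB Require Import structures.
From mathcomp Require Import all_boot all_order all_algebra.

Set Implicit Arguments.
Unset Strict Implicit.
Unset Printing Implicit Defensive.

Import GRing.Theory.

Definition is_partition_of (n : nat) (s : seq nat) : bool :=
  [&& sorted geq s, all (fun x => 0 < x) s & sumn s == n].

Record intpart (n : nat) : Type := IntPart {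
  parts :> seq nat;
  partsP : is_partition_of n parts
}.

HB.instance Definition _ (n : nat) := [isSub for @parts n].
HB.instance Definition _ (n : nat) := [Countable of intpart n by <:].

(* A partition of n has at most n parts, each at most n, so it embeds in the
   finite type of sequences of length at most n over 'I_n.+1. *)
Section IntpartFinite.

Variable n : nat.

Definition intpart_to_bseq (p : intpart n) : n.-bseq 'I_n.+1 :=
  insub_bseq n [seq inord x | x <- parts p].

Definition intpart_of_bseq (b : n.-bseq 'I_n.+1) : option (intpart n) :=
  insub [seq nat_of_ord i | i <- b].

Lemma intpart_size (p : intpart n) : size p <= n.
Proof.
case: p => s /= /and3P[_ s_gt0 /eqP <-].
by elim: s s_gt0 => //= x s IHs /andP[x_gt0 /IHs]; rewrite -add1n; apply: leq_add.
Qed.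

Lemma intpart_leq (p : intpart n) x : x \in parts p -> x <= n.
Proof.
case: p => s /= /and3P[_ _ /eqP <-].
elim: s => //= y s IHs; rewrite inE => /predU1P[-> | /IHs le_x].
  exact: leq_addr.
exact: leq_trans le_x (leq_addl _ _).
Qed.

Lemma intpart_to_bseqK : pcancel intpart_to_bseq intpart_of_bseq.
Proof.
move=> p; rewrite /intpart_of_bseq /intpart_to_bseq /insub_bseq val_insubd.
rewrite size_map intpart_size -map_comp.
rewrite (_ : map _ _ = val p) ?valK //.
by apply: map_id_in => x /intpart_leq le_x /=; rewrite inordK.
Qed.

End IntpartFinite.

HB.instance Definition _ (n : nat) : isFinite (intpart n) :=
  PCanIsFinite (@intpart_to_bseqK n).

(* \lambda_1 - \lambda_2 + \lambda_3 - ... : the largest part has index 0. *)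
Definition alt_sum (s : seq nat) : int :=
  (\sum_(i < size s) (-1) ^+ i * (nth 0%N s i)%:Z)%R.

Definition nb_odd_parts (s : seq nat) : nat := count odd s.

Definition even_parts_at_most (b : nat) (s : seq nat) : bool :=
  all (fun x => ~~ odd x ==> (count_mem x s <= b)) s.

(* Main.v *)
(** Conjugation matches the alternating sum with the number of odd parts on all
    partitions of [n].  Adding an even number [D] of copies of an even part [x]
    changes neither statistic, so for either of them the partitions in which [x]
    occurs at least [D] times are counted by the partitions of [n - D x].
    Imposing the bound on the even parts 2, 4, 6, ... one at a time therefore
    preserves the equality of the two counts. *)

Require Import Defs.
From mathcomp Require Import all_boot all_order all_algebra.
From mathcomp Require Import zify.

Set Implicit Arguments.
Unset Strict Implicit.
Unset Printing Implicit Defensive.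

Lemma geq_trans : transitive geq.
Proof. by move=> y x z /= yx zy; apply: leq_trans zy yx. Qed.

Lemma geq_total : total geq.
Proof. by move=> x y; apply: leq_total. Qed.

Lemma geq_anti : antisymmetric geq.
Proof. by move=> x y /= H; apply/eqP; rewrite eqn_leq andbC. Qed.

Lemma leq_sumn (s : seq nat) x : x \in s -> x <= sumn s.
Proof.
elim: s => //= y s IHs; rewrite inE => /predU1P[-> | /IHs]; first exact: leq_addr.
by move=> le_x; apply: leq_trans le_x (leq_addl _ _).
Qed.

(** * The alternating sum and conjugation *)

Lemma alt_sum_cons x s : alt_sum (x :: s) = (x%:Z - alt_sum s)%R.
Proof.
rewrite /alt_sum big_ord_recl /= GRing.expr0 GRing.mul1r; congr (_ + _)%R.
rewrite -GRing.sumrN; apply: eq_bigr => i _.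
by rewrite /bump /= add1n GRing.exprS GRing.mulN1r GRing.mulNr.
Qed.

(** Prepending a largest part [x] turns the alternating sum [a] into [x - a]; correspondingly, it
    flips the parity of the number of parts exceeding [i] precisely for [i < x]. The free bound [N]
    lets two sequences be compared over one index range. *)
Lemma alt_sum_count N s : sorted geq s -> all (fun x => x <= N) s ->
  alt_sum s = (\sum_(0 <= i < N) odd (count (ltn i) s))%:Z%R.
Proof.
elim: s => [|x s IHs] /=.
  by rewrite /alt_sum big_ord0 big1.
move=> xs /andP[xN sN]; rewrite alt_sum_cons IHs ?(path_sorted xs) //.
have s_le : all (fun y => y <= x) s by apply: order_path_min xs; apply: geq_trans.
have c0 i : x <= i -> count (ltn i) s = 0.
  move=> xi; apply/eqP; rewrite -leqn0 leqNgt -has_count; apply/hasPn => y ys /=.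
  by move/allP: s_le => /(_ y ys); lia.
have cut F : (forall i, x <= i -> F i = 0) ->
    \sum_(0 <= i < N) F i = \sum_(0 <= i < x) F i.
  move=> F0; rewrite (big_cat_nat (leq0n x) xN) /= [X in _ + X]big_nat.
  by rewrite [X in _ + X]big1 ?addn0 // => i /andP[xi _]; apply: F0.
rewrite (cut (fun i => odd (count (ltn i) s))) => [|i xi]; last by rewrite c0.
rewrite (cut (fun i => odd ((i < x) + count (ltn i) s))) => [|i xi]; last first.
  by rewrite c0 // addn0 ltnNge xi.
(* For each [i < x] exactly one of the two parities is odd, so the sums add up to [x]. *)
have : \sum_(0 <= i < x) odd ((i < x) + count (ltn i) s)
     + \sum_(0 <= i < x) odd (count (ltn i) s) = x.
  rewrite -big_split /= -[RHS]subn0 -[RHS]muln1 -sum_nat_const_nat.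
  apply: eq_big_nat => i /andP[_ ->]; rewrite oddD /=.
  by case: (odd _).
by lia.
Qed.

(** Column lengths of the Young diagram; stopping at the largest part keeps every entry positive. *)
Definition conj_parts (s : seq nat) : seq nat :=
  [seq count (ltn i) s | i <- iota 0 (head 0 s)].

Lemma sorted_geq_le_head s : sorted geq s -> all (fun x => x <= head 0 s) s.
Proof.
case: s => //= x s xs; rewrite leqnn /=.
by apply: order_path_min xs; apply: geq_trans.
Qed.

(** Double counting of the cells [(i, x)] with [i < x]. *)
Lemma sumn_conj_parts s : sorted geq s -> sumn (conj_parts s) = sumn s.
Proof.
move=> /sorted_geq_le_head; rewrite /conj_parts; move: (head 0 s) => h.
rewrite sumnE big_map => sh.
have -> : \sum_(j <- iota 0 h) count (ltn j) s
        = \sum_(j <- iota 0 h) \sum_(x <- s) (j < x).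
  by apply: eq_bigr => i _; rewrite -sum1_count big_mkcond; apply: eq_bigr => x _ /=; case: ltnP.
rewrite exchange_big /= sumnE big_seq [RHS]big_seq; apply: eq_bigr => x xs.
move/allP: sh => /(_ x xs) xh.
rewrite -{1}(subnKC xh) iotaD big_cat /= add0n.
rewrite [X in _ + X]big_seq [X in _ + X]big1; last first.
  by move=> i; rewrite mem_iota => /andP[xi _]; rewrite ltnNge xi.
rewrite addn0 -[RHS](size_iota 0) -sum1_size big_seq [RHS]big_seq.
by apply: eq_bigr => i; rewrite mem_iota add0n => /andP[_ ->].
Qed.

Lemma conj_parts_partition n (l : intpart n) : is_partition_of n (conj_parts l).
Proof.
case: l => s /= /and3P[ss s0 /eqP sn]; apply/and3P; split.
- rewrite sorted_map; apply: sub_sorted (iota_sorted 0 _) => i j ij /=.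
  by apply: sub_count => y /=; apply: leq_ltn_trans.
- apply/allP => y /mapP[i]; rewrite mem_iota add0n => /andP[_ ih] ->.
  by rewrite -has_count; case: s ih {ss s0 sn} => //= x s ->.
- by rewrite sumn_conj_parts // sn.
Qed.

Definition conj_intpart n (l : intpart n) : intpart n :=
  IntPart (conj_parts_partition l).

Lemma nth_conj_parts s i : sorted geq s -> nth 0 (conj_parts s) i = count (ltn i) s.
Proof.
move=> /sorted_geq_le_head sh; have [ih | hi] := ltnP i (head 0 s).
  by rewrite (nth_map 0) ?size_iota // nth_iota.
rewrite nth_default ?size_map ?size_iota //; apply/esym/eqP.
rewrite -leqn0 leqNgt -has_count; apply/hasPn => y ys /=.
by move/allP: sh => /(_ y ys); lia.
Qed.

(** The multiplicity of [x.+1] is the difference of two consecutive column lengths, so the columns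
    determine the partition. *)
Lemma conj_intpart_inj n : injective (@conj_intpart n).
Proof.
move=> [s Ps] [t Pt] /(congr1 val) /= eq_st; apply: val_inj => /=.
have /and3P[ss s0 _] := Ps; have /and3P[st t0 _] := Pt.
have count_st i : count (ltn i) s = count (ltn i) t.
  by rewrite -!nth_conj_parts // eq_st.
have count_mem0 r : all (fun x => 0 < x) r -> count_mem 0 r = 0.
  by move/allP=> r0; apply/count_memPn/negP => /r0.
have count_memS r x : count_mem x.+1 r + count (ltn x.+1) r = count (ltn x) r.
  by elim: r => //= y r <-; rewrite addnACA; congr (_ + _); lia.
apply: (sorted_eq geq_trans geq_anti) => //; apply/allP => -[|x] _ /=.
  by rewrite !count_mem0.
by rewrite -(eqn_add2r (count (ltn x.+1) s)) count_memS (count_st x.+1) count_memS count_st.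
Qed.

Lemma alt_sum_conj n (l : intpart n) :
  alt_sum l = (nb_odd_parts (conj_intpart l))%:Z%R.
Proof.
case: l => s Ps /=; have /and3P[ss _ _] := Ps.
rewrite (alt_sum_count (N := head 0 s)) ?sorted_geq_le_head //.
congr Posz; rewrite /nb_odd_parts /= /conj_parts count_map -sum1_count [RHS]big_mkcond /=.
by rewrite /index_iota subn0; apply: eq_bigr => i _; case: odd.
Qed.

Lemma card_alt_sum_odd n k :
  #|[set l : intpart n | (alt_sum l == k%:Z)%R]|
  = #|[set u : intpart n | nb_odd_parts u == k]|.
Proof.
rewrite -[RHS](card_preimset _ (@conj_intpart_inj n)).
by apply: eq_card => l; rewrite !inE alt_sum_conj.
Qed.

(** * Bounding the multiplicities of the even parts *)

(** Only the first [j] even numbers 2, 4, ..., 2j are constrained, which allows induction on [j]. *)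
Definition even_mults_lt (D j : nat) (s : seq nat) : bool :=
  all (fun i => count_mem i.+1.*2 s < D) (iota 0 j).

(** Both sequences are sorted because the alternating sum depends on the order of the parts. *)
Definition stable_under_copies (D : nat) (P : pred (seq nat)) : Prop :=
  forall x s t, ~~ odd x -> sorted geq s -> sorted geq t ->
  perm_eq t (nseq D x ++ s) -> P t = P s.

(** Each number of parts exceeding [i] grows by 0 or by the even number [D], so its parity is
    kept. *)
Lemma stable_alt_sum D (k : int) : ~~ odd D ->
  stable_under_copies D (fun s => alt_sum s == k).
Proof.
move=> evD x s t _ ss st pts; congr (_ == _).
pose N := sumn t.
have tN : all (fun y => y <= N) t by apply/allP => y; apply: leq_sumn.
have sN : all (fun y => y <= N) s.
  by move: tN; rewrite (perm_all _ pts) all_cat => /andP[].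
rewrite (alt_sum_count st tN) (alt_sum_count ss sN); congr Posz.
apply: eq_bigr => i _; rewrite (permP pts) count_cat count_nseq oddD oddM.
by rewrite (negbTE evD) andbF.
Qed.

Lemma stable_nb_odd_parts D k :
  stable_under_copies D (fun s => nb_odd_parts s == k).
Proof.
move=> x s t evx _ _ pts; rewrite /nb_odd_parts (permP pts) count_cat count_nseq.
by rewrite (negbTE evx).
Qed.

Lemma insert_copies_partition D x n (l : intpart n) : 0 < x ->
  is_partition_of (D * x + n) (sort geq (nseq D x ++ l)).
Proof.
case: l => s /= /and3P[ss s0 /eqP sn] x0; apply/and3P; split.
- exact: sort_sorted geq_total _.
- by rewrite all_sort all_cat s0 all_nseq x0 orbT.
- by rewrite (perm_sumn (permEl (perm_sort _ _))) sumn_cat sumn_nseq sn mulnC.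
Qed.

Definition insert_copies D x n (x0 : 0 < x) (l : intpart n) : intpart (D * x + n) :=
  IntPart (insert_copies_partition D l x0).

Lemma insert_copies_inj D x n (x0 : 0 < x) : injective (@insert_copies D x n x0).
Proof.
move=> [s Ps] [t Pt] /(congr1 val) /= eq_st; apply: val_inj => /=.
have /and3P[ss _ _] := Ps; have /and3P[st _ _] := Pt.
apply: (sorted_eq geq_trans geq_anti) => //.
by rewrite -(perm_cat2l (nseq D x)) -(perm_sort geq) eq_st perm_sort.
Qed.

Lemma remove_copies D x n (l : intpart n) : D <= count_mem x l ->
  {s | is_partition_of (n - D * x) s & perm_eq l (nseq D x ++ s)}.
Proof.
case: l => t /= /and3P[st t0 /eqP tn] Dt.
have sub : subseq (nseq D x) t.
  apply: (@subseq_trans _ (filter (pred1 x) t)); last exact: filter_subseq.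
  have -> : filter (pred1 x) t = nseq (count_mem x t) x.
    by rewrite -size_filter; apply/all_pred1P/filter_all.
  by rewrite -(subnKC Dt) nseqD prefix_subseq.
have [r pr] := perm_to_subseq sub.
have pr' : perm_eq t (nseq D x ++ sort geq r).
  by apply: perm_trans pr _; rewrite perm_cat2l perm_sym perm_sort.
exists (sort geq r) => //; apply/and3P; split.
- exact: sort_sorted geq_total _.
- by move: t0; rewrite (perm_all _ pr') all_cat => /andP[].
- by rewrite -tn (perm_sumn pr') sumn_cat sumn_nseq mulnC addKn.
Qed.

Definition nb_bounded (P : pred (seq nat)) D j n : nat :=
  #|[set l : intpart n | P l && even_mults_lt D j l]|.

Lemma even_mults_ltS D j s :
  even_mults_lt D j.+1 s = even_mults_lt D j s && (count_mem j.+1.*2 s < D).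
Proof. by rewrite /even_mults_lt -{1}[j.+1]addn1 iotaD all_cat /= andbT add0n. Qed.

Lemma even_mults_lt_insert D j s t :
  perm_eq t (nseq D j.+1.*2 ++ s) -> even_mults_lt D j t = even_mults_lt D j s.
Proof.
move=> pts; apply: eq_in_all => i; rewrite mem_iota add0n => /andP[_ ij].
rewrite (permP pts) count_cat count_nseq /=.
by have -> : (j.+1.*2 == i.+1.*2) = false by lia.
Qed.

(** [D] copies of the next even part would already exceed [n]. *)
Lemma nb_bounded_small P D j n : n < D * j.+1.*2 ->
  nb_bounded P D j n = nb_bounded P D j.+1 n.
Proof.
move=> nD; apply: eq_card => l; rewrite !inE even_mults_ltS.
case: (ltnP (count_mem _ l) D) => [|Dl]; first by rewrite andbT.
have [s /and3P[_ _ /eqP sn] pls] := remove_copies Dl.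
have /and3P[_ _ /eqP ln] := partsP l.
by move: ln; rewrite (perm_sumn pls) sumn_cat sumn_nseq; lia.
Qed.

(** Split according to whether [x] occurs fewer than [D] times; inserting [D] copies of [x] is a
    bijection from the partitions of [n] onto the other class, and leaves the multiplicities of the
    smaller even parts alone. *)
Lemma nb_bounded_rec P D j n : stable_under_copies D P ->
  nb_bounded P D j (D * j.+1.*2 + n)
  = nb_bounded P D j.+1 (D * j.+1.*2 + n) + nb_bounded P D j n.
Proof.
move=> stP; set x := j.+1.*2; have x0 : 0 < x by [].
have evx : ~~ odd x by rewrite odd_double.
rewrite /nb_bounded -(card_imset _ (@insert_copies_inj D x n x0)).
rewrite -(cardsID [set l : intpart _ | count_mem x l < D]).
congr (_ + _); apply: eq_card => l.
  by rewrite !inE even_mults_ltS andbA.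
rewrite !inE -leqNgt; apply/andP/imsetP => [[Dl /andP[Pl bl]] | [u]].
  have [s Ps pls] := remove_copies Dl; move: (Ps); rewrite addKn => Ps'.
  have /and3P[sl _ _] := partsP l; have /and3P[ss _ _] := Ps.
  exists (IntPart Ps').
    by rewrite inE /= -(stP _ _ _ evx ss sl pls) Pl -(even_mults_lt_insert pls).
  apply: val_inj; apply: (sorted_eq geq_trans geq_anti) => //=.
    exact: sort_sorted geq_total _.
  by rewrite perm_sym perm_sort perm_sym.
rewrite inE => /andP[Pu bu] ->.
have pr : perm_eq (insert_copies D x0 u) (nseq D x ++ u) by rewrite /= perm_sort.
have /and3P[su _ _] := partsP u.
have /and3P[si _ _] := partsP (insert_copies D x0 u).
split; last by rewrite (stP _ _ _ evx su si pr) Pu (even_mults_lt_insert pr).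
by rewrite (permP pr) count_cat count_nseq /= eqxx mul1n leq_addr.
Qed.

Lemma eq_nb_bounded P Q D :
  stable_under_copies D P -> stable_under_copies D Q ->
  (forall n, #|[set l : intpart n | P l]| = #|[set l : intpart n | Q l]|) ->
  forall j n, nb_bounded P D j n = nb_bounded Q D j n.
Proof.
move=> stP stQ eqPQ; elim=> [|j IHj] n.
  by have := eqPQ n; congr (_ = _); apply: eq_card => l; rewrite !inE andbT.
case: (ltnP n (D * j.+1.*2)) => [nD | Dn].
  by rewrite -!nb_bounded_small.
rewrite -(subnKC Dn); move: (n - _) => p.
(* Adding the level-[j] count at [p] to both sides turns each into a level-[j] count, without any
   subtraction. *)
by apply/eqP; rewrite -(eqn_add2r (nb_bounded P D j p)) {2}IHj -!nb_bounded_rec // IHj.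
Qed.

(** An even part of a partition of [n] is 2(i+1) with [i < n], and even numbers that are not parts
    have multiplicity 0. *)
Lemma even_parts_at_most_mults b n (l : intpart n) :
  even_parts_at_most b l = even_mults_lt b.+1 n l.
Proof.
case: l => s Ps /=; have /and3P[_ /allP s0 /eqP sn] := Ps.
apply/allP/allP => [bs i _ | bs x xs].
  have [xs | /count_memPn -> //] := boolP (i.+1.*2 \in s).
  by move/implyP: (bs _ xs); apply; rewrite odd_double.
apply/implyP => evx; have x0 := s0 _ xs; have xn := leq_sumn xs.
have -> : x = (x./2.-1).+1.*2 by lia.
by apply: bs; rewrite mem_iota; lia.
Qed.

Theorem theorem3p2 (k m n : nat) :
  #|[set l : intpart n |
      (alt_sum l == k%:Z)%R && even_parts_at_most (2 * m + 1) l]| =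
  #|[set u : intpart n |
      (nb_odd_parts u == k) && even_parts_at_most (2 * m + 1) u]|.
Proof.
(* At most [2 * m + 1] copies means fewer than [D = 2 * m + 2], an even number as stability of the
   alternating sum demands. *)
have evD : ~~ odd (2 * m + 1).+1 by lia.
have := eq_nb_bounded (stable_alt_sum k evD) (@stable_nb_odd_parts _ k)
          (fun p => card_alt_sum_odd p k) n n.
by congr (_ = _); apply: eq_card => l; rewrite !inE even_parts_at_most_mults.
Qed.
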